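(* Let $\mathbb A$ be a finite alphabet with $|\mathbb A|=t\geq 2$ and let $x\in \mathbb A^{\mathbb N}$ be an Arnoux-Rauzy word. Let $\varepsilon=B_0,B_1,B_2,\ldots$ be the bispecial factors of $x$ listed in order of increasing length and put $b_k=|B_k|$. For each $k\in\omega=\{0,1,2,\ldots\}$ and $a\in\mathbb A$ let $p_a^{(k)}$ be the length of the first return to $B_k$ in $x$ whose complete first return begins with $B_ka$, and set $p_k=\min_{b\in\mathbb A}p_b^{(k)}$. Define the integer interval $I_{k,a}=[\,b_k-2p_k+p_a^{(k)}+2,\; b_k+p_a^{(k)}\,]$, and for $n\in I_{k,a}$ let $d(n,I_{k,a})$ denote the minimal distance from $n$ to the two endpoints of $I_{k,a}$. For $a\in\mathbb A$ and $n\in\mathbb N$ put \[F(a,n)=\sum_{\substack{k\in\omega\\ n\in I_{k,a}}}\bigl(d(n,I_{k,a})+1\bigr).\] Then for every $n\in\mathbb N=\{1,2,\ldots\}$, the number $f_x^c(n)$ of distinct closed factors of $x$ of length $n$ equals $\sum_{a\in\mathbb A}F(a,n)$.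
   Context: An infinite word $x\in\mathbb A^{\mathbb N}$ is an Arnoux-Rauzy word if it is recurrent and for each $n\geq 0$ it has exactly one right special factor $R_n$ of length $n$ and exactly one left special factor $L_n$ of length $n$, where moreover $R_nc$ is a factor of $x$ for every $c\in\mathbb A$ and $cL_n$ is a factor of $x$ for every $c\in\mathbb A$. A factor $v$ is right (left) special if $vc,vd$ (resp. $cv,dv$) are factors for some distinct letters $c,d$; bispecial means both. For factors $u,v$ of $x$, $u$ is a first return to $v$ if $uv$ is a factor of $x$ containing exactly two occurrences of $v$, one as a prefix and one as a suffix; $uv$ is then a complete first return to $v$. A finite word $u\in\mathbb A^+$ is closed if either $u\in\mathbb A$ or $u$ contains exactly two occurrences of some nonempty proper factor $v$, one as a prefix and one as a suffix; otherwise $u$ is open. $f_x^c(n)$ counts the distinct closed factors of $x$ of length $n$. *)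

(* Defs.v *)
(* MathComp (classical sets and finitely supported sums from mathcomp.classical) *)
From HB Require Import structures.
From mathcomp Require Import all_boot all_order all_algebra.
From mathcomp Require Import boolp classical_sets cardinality fsbigop.

Set Implicit Arguments.
Unset Strict Implicit.
Unset Printing Implicit Defensive.

Import Order.TTheory GRing.Theory Num.Theory.

Local Open Scope classical_set_scope.

Section Words.
Variable A : finType.
Implicit Types (x : nat -> A) (u v w : seq A).

Definition occurs_at x u (i : nat) : Prop :=
  u = mkseq (fun j => x (i + j)) (size u).

Definition factor x u : Prop := exists i, occurs_at x u i.

Definition recurrent x : Prop :=
  forall u, factor x u -> forall N, exists2 i, N <= i & occurs_at x u i.

Definition right_special x v : Prop :=
  factor x v /\
  exists c d, [/\ c <> d, factor x (rcons v c) & factor x (rcons v d)].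

Definition left_special x v : Prop :=
  factor x v /\
  exists c d, [/\ c <> d, factor x (c :: v) & factor x (d :: v)].

Definition bispecial x v : Prop := right_special x v /\ left_special x v.

Definition arnoux_rauzy x : Prop :=
  [/\ recurrent x,
      forall n, exists R,
        unique (fun v => size v = n /\ right_special x v) R /\
        forall c, factor x (rcons R c)
    & forall n, exists L,
        unique (fun v => size v = n /\ left_special x v) L /\
        forall c, factor x (c :: L)].

(* Occurrences may overlap; the empty word occurs [(size u).+1] times in [u]. *)
Definition nb_occ v u : nat :=
  count (fun i => prefix v (drop i u)) (iota 0 (size u).+1).

Definition two_end_occ v u : Prop :=
  [/\ nb_occ v u = 2, prefix v u & suffix v u].

Definition closed_word u : Prop :=
  size u = 1 \/
  exists v, [/\ v <> [::], infix v u, v <> u & two_end_occ v u].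

Definition nb_closed_factors x (n : nat) : nat :=
  #|[pred w : n.-tuple A | `[< factor x w /\ closed_word w >]]|.

Definition first_return x v u : Prop :=
  factor x (u ++ v) /\ two_end_occ v (u ++ v).

(* The bispecial factors of an Arnoux-Rauzy word have pairwise distinct lengths,
   so listing them by increasing length is a strictly increasing enumeration. *)
Definition bispecial_listing x (B : nat -> seq A) : Prop :=
  [/\ forall k, bispecial x (B k),
      forall v, bispecial x v -> exists k, v = B k
    & forall k l, k < l -> size (B k) < size (B l)].

Definition return_lengths x (B : nat -> seq A) (p : nat -> A -> nat) : Prop :=
  forall k a, exists u,
    [/\ first_return x (B k) u, prefix (rcons (B k) a) (u ++ B k)
      & size u = p k a].

(* A minimum over the alphabet, which is nonempty as it contains [x 0]; that
   letter only provides the starting value of the iterated minimum. *)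
Definition min_return x (p : nat -> A -> nat) (k : nat) : nat :=
  \big[minn/p k (x 0)]_(b : A) p k b.

(* Integer-valued, since [size (B k)] can be less than [2 * min_return x p k]. *)
Definition I_lo x (B : nat -> seq A) (p : nat -> A -> nat) (k : nat) (a : A) : int :=
  ((size (B k))%:Z - 2 * (min_return x p k)%:Z + (p k a)%:Z + 2)%R.

Definition I_hi (B : nat -> seq A) (p : nat -> A -> nat) (k : nat) (a : A) : int :=
  ((size (B k))%:Z + (p k a)%:Z)%R.

Definition I_indices x B p (a : A) (n : nat) : set nat :=
  [set k | (I_lo x B p k a <= n%:Z <= I_hi B p k a)%R].

Definition dist_ends x B p (k : nat) (a : A) (n : nat) : nat :=
  minn (absz (n%:Z - I_lo x B p k a)%R) (absz (n%:Z - I_hi B p k a)%R).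

(* The sum over a finite set of indices; by convention it is 0 if infinitely
   many indices contribute. *)
Definition F_sum x B p (a : A) (n : nat) : nat :=
  \big[addn/0]_(k \in I_indices x B p a n) (dist_ends x B p k a n).+1.

End Words.

(* Main.v *)
(* Each closed word of length [n] is the complete first return to exactly one
   word [v], possibly empty.  In an Arnoux-Rauzy word every factor [v] extends,
   at all its occurrences, to one and the same bispecial factor [B_k = s v t], and
   [w |-> s w t] is a bijection from the complete first returns to [v] onto those
   to [B_k]; the latter have lengths [b_k + p_a^(k)], one for each letter [a].
   A factorization [B_k = s v t] arises in this way iff [s] and [t] are both shorter
   than [p_k], because [p_k] is a period of [B_k] and [b_j + p_k <= b_k] for [j < k].
   Counting the positions [|s|] for a given length of [v] produces the weights
   [d(n, I_{k,a}) + 1]. *)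
Require Import Defs.
From mathcomp Require Import all_boot all_order all_algebra.
From mathcomp Require Import boolp classical_sets cardinality fsbigop.
From mathcomp Require Import zify.

Set Implicit Arguments.
Unset Strict Implicit.
Unset Printing Implicit Defensive.

(** * Arnoux-Rauzy languages and their reversal *)

Section Languages.
Variable A : finType.
Implicit Types (L : seq A -> Prop) (u v w s t y z : seq A).

Definition rspecial L v := exists c d, [/\ c <> d, L (rcons v c) & L (rcons v d)].

Definition lspecial L v := exists c d, [/\ c <> d, L (c :: v) & L (d :: v)].

(* The axioms are exchanged by reversal, so each one-sided result is proved
   only on the right. *)
Definition ar_language L :=
  [/\ forall u v w, L (u ++ v ++ w) -> L v,
      forall u v, L u -> L v -> exists w, L (u ++ w ++ v),
      forall n, exists R, [/\ size R = n, forall c, L (rcons R c)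
        & forall v, size v = n -> rspecial L v -> v = R]
    & forall n, exists R, [/\ size R = n, forall c, L (c :: R)
        & forall v, size v = n -> lspecial L v -> v = R]].

(* The size conditions discard the occurrences of [v] too close to an end of the
   ambient word. *)
Definition forced L s v t := forall y z, L (y ++ v ++ z) ->
  size s <= size y -> size t <= size z ->
  exists y' z', y = y' ++ s /\ z = t ++ z'.

Definition revl L u := L (rev u).

Lemma ar_language_rev L : ar_language L -> ar_language (revl L).
Proof.
rewrite /revl => -[fac rec rs ls]; split.
- by move=> u v w; rewrite !rev_cat -catA => /fac.
- move=> u v Lu Lv; have [w Lw] := rec _ _ Lv Lu.
  by exists (rev w); rewrite !rev_cat revK -catA.
- move=> n; have [R [sR LR uR]] := ls n; exists (rev R); split.
  + by rewrite size_rev.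
  + by move=> c; rewrite rev_rcons revK.
  + move=> v sv [c [d [cd Lc Ld]]]; rewrite -(uR (rev v)) ?revK ?size_rev//.
    by exists c, d; rewrite -!rev_rcons.
- move=> n; have [R [sR LR uR]] := rs n; exists (rev R); split.
  + by rewrite size_rev.
  + by move=> c; rewrite rev_cons revK.
  + move=> v sv [c [d [cd Lc Ld]]]; rewrite -(uR (rev v)) ?revK ?size_rev//.
    by exists c, d; rewrite -!rev_cons.
Qed.

Lemma rspecial_rev L v : lspecial L v <-> rspecial (revl L) (rev v).
Proof.
by split=> -[c [d [cd Lc Ld]]]; exists c, d; move: Lc Ld;
   rewrite /revl !rev_rcons !revK.
Qed.

Lemma lspecial_rev L v : rspecial L v <-> lspecial (revl L) (rev v).
Proof.
by split=> -[c [d [cd Lc Ld]]]; exists c, d; move: Lc Ld;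
   rewrite /revl !rev_cons !revK.
Qed.

Lemma forced_rev L s v t :
  forced L s v t <-> forced (revl L) (rev t) (rev v) (rev s).
Proof.
split=> H y z.
  rewrite /revl !size_rev !rev_cat revK -catA => Lv st sz.
  have [||y' [z' [Ey Ez]]] := H _ _ Lv; rewrite ?size_rev//.
  by exists (rev z'), (rev y'); rewrite -!rev_cat -Ez -Ey !revK.
move=> Lv sy sz; have [|||y' [z' [Ey Ez]]] := H (rev z) (rev y); rewrite ?size_rev//.
  by rewrite /revl !rev_cat !revK -catA.
exists (rev z'), (rev y').
by rewrite -(revK t) -(revK s) -!rev_cat -Ez -Ey !revK.
Qed.

End Languages.

(** * Extensions forced on a factor, and what limits their length *)

Section Forced.
Variables (A : finType) (L : seq A -> Prop).
Hypotheses (A_gt1 : 1 < #|A|) (arL : ar_language L).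
Implicit Types (u v w s t y z : seq A).

Let fac u v w : L (u ++ v ++ w) -> L v.
Proof. by case: arL => + _ _ _ => /(_ u v w). Qed.

Let rec u v : L u -> L v -> exists w, L (u ++ w ++ v).
Proof. by case: arL => _ + _ _ => /(_ u v). Qed.

Lemma lang_prefix u v : L (u ++ v) -> L u.
Proof. exact: (@fac [::]). Qed.

Lemma lang_suffix u v : L (u ++ v) -> L v.
Proof. by rewrite -{1}(cats0 v) => /fac. Qed.

(** A special word [R] of length [n] serves as padding: recurrence puts one copy of it before [u]
    and another after. *)
Lemma lang_room u n : L u ->
  exists y z, [/\ L (y ++ u ++ z), n <= size y & n <= size z].
Proof.
move=> Lu; case: arL => _ _ /(_ n)[R [sR LR _]] _.
have [c _] : exists c : A, c \in predT by apply/card_gt0P; exact: leq_trans A_gt1.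
have LRR : L R by move: (LR c); rewrite -cats1 => /lang_prefix.
have [w Lw] := rec Lu LRR; have [w' Lw'] := rec LRR Lw.
exists (R ++ w'), (w ++ R); split; rewrite ?size_cat ?sR; try lia.
by rewrite -!catA.
Qed.

Lemma forced0 v : forced L [::] v [::].
Proof. by move=> y z _ _ _; exists y, z; rewrite cats0. Qed.

Lemma forced_cons s v c t : L (rcons v c) -> ~ rspecial L v ->
  forced L s (rcons v c) t -> forced L s v (c :: t).
Proof.
move=> Lvc nrs H y [|d z]// Lv sy /= sz.
have cd : d = c.
  apply: contrapT => cd; apply: nrs; exists d, c; split=> //.
  by apply: (@fac y _ z); rewrite cat_rcons.
rewrite cd in Lv *; have [|y' [z' [Ey Ez]]] := H y z _ sy sz.
  by rewrite cat_rcons.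
by exists y', z'; rewrite Ey Ez.
Qed.

(** If [s'] were longer than [s], one fixed letter of [s'] would precede every occurrence of
    [s ++ v ++ t] with enough room around it, and this word could not be left special. *)
Lemma forced_lspecial s v t s' t' : lspecial L (s ++ v ++ t) ->
  forced L s' v t' -> size s' <= size s.
Proof.
move=> [c [d [cd Lc Ld]]] H; rewrite leqNgt; apply/negP => lts.
have last_letter e : L (e :: s ++ v ++ t) ->
    e = nth e s' (size s' - (size s).+1).
  move=> Le; have [y [z [Lyz sy sz]]] := lang_room (size s' + size t') Le.
  have [|||y' [z' [Ey Ez]]] := H (y ++ e :: s) (t ++ z).
  - by rewrite -!catA /= -!catA in Lyz *.
  - by rewrite size_cat; lia.
  - by rewrite size_cat; lia.
  have Es := congr1 size Ey; rewrite !size_cat /= in Es.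
  move: (congr1 (fun r => nth e r (size y)) Ey).
  rewrite nth_cat ltnn subnn /= => {1}->; rewrite nth_cat ifN; last by lia.
  by congr nth; lia.
(* The index lies inside [s'], so the differing default letters do not matter. *)
apply: cd; rewrite (last_letter c Lc) (last_letter d Ld).
by apply: set_nth_default; lia.
Qed.

(* If no forced right extension of [v] is right special, then [v] is followed by a
   single infinite word; as [v] recurs, that word has a period [P], which
   contradicts the existence of a right special factor of length [P]. *)
Lemma rspecial_forced v : L v -> exists t, rspecial L (v ++ t) /\ forced L [::] v t.
Proof.
move=> Lv; apply: contrapT => nex.
have [a a_nv] : exists a, L (rcons v a).
  have [y [[|a z] [Lyz _ sz]]] := lang_room 1 Lv => //.
  by exists a; apply: (@fac y _ z); rewrite cat_rcons.
(* The next letter is read off one occurrence of [v]; another letter elsewhere would make [v ++ t]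
   right special, against [nex]. *)
have ft n : exists2 t, size t = n & forced L [::] v t.
  elim: n => [|n [t st Ht]]; first by exists [::] => //; exact: forced0.
  have [y [z [Lyz _ sz]]] := lang_room n.+1 Lv.
  have [||y' [z' [Ey Ez]]] := Ht _ _ Lyz; rewrite ?st//; try lia.
  case: z' Ez => [Ez|c z' Ez]; first by rewrite Ez size_cat /= in sz; lia.
  exists (rcons t c); rewrite ?size_rcons ?st// => y1 z1 L1 _.
  rewrite size_rcons => s1.
  have [||y2 [z2 [_ Ez1]]] := Ht _ _ L1; rewrite ?st//; try lia.
  case: z2 Ez1 => [Ez1|d z2 Ez1]; first by rewrite Ez1 size_cat /= in s1; lia.
  exists y1, z2; rewrite cats0 cat_rcons Ez1; split=> //; congr (_ ++ _ :: _).
  apply: contrapT => cd; apply: nex; exists t; split=> //.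
  exists d, c; split=> //.
    by apply: (@fac y1 _ z2); rewrite cat_rcons -catA -Ez1.
  by apply: (@fac y _ z'); rewrite cat_rcons -catA -Ez.
(* The two copies of [v] in [v a w v] start [P] letters apart and have the same continuation, which
   gives the period [P]. *)
have [w Lw] := rec a_nv Lv.
pose P := (size v + 1 + size w)%N.
case: arL => _ _ /(_ P)[R [sR LR _]] _.
have /card_gt1P[c [d [_ _ /eqP cd]]] := A_gt1.
have [w1 L1] := rec Lv (LR c); have [w2 L2] := rec Lv (LR d).
(* With this [N], both [rcons R c] and [rcons R d] lie inside the one word [v ++ t]. *)
pose N := (size (v ++ w1 ++ rcons R c) + size (v ++ w2 ++ rcons R d))%N.
have [t st Ht] := ft N.
have per i : i + P < size v + N -> nth a (v ++ t) (i + P) = nth a (v ++ t) i.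
  move=> lti; have [y [z [Lyz _ sz]]] := lang_room N Lw.
  have [|||y1 [z1 [_ E1]]] := Ht y (a :: w ++ v ++ z); rewrite ?st//.
  - by rewrite -!catA cat_rcons in Lyz.
  - by rewrite /= !size_cat; lia.
  have [|||y2 [z2 [_ E2]]] := Ht (y ++ rcons v a ++ w) z; rewrite ?st//.
    by rewrite -!catA in Lyz *.
  have -> : nth a (v ++ t) (i + P) = nth a (v ++ a :: w ++ v ++ z) (i + P).
    by rewrite E1 catA [RHS]nth_cat size_cat st lti.
  have -> : v ++ a :: w ++ v ++ z = (v ++ a :: w) ++ v ++ z by rewrite -catA.
  rewrite nth_cat size_cat /= ifN; last by lia.
  rewrite E2 [v ++ t ++ z2]catA nth_cat size_cat st ifT; last by lia.
  by congr nth; lia.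
(* As [R] has length [P], the letter [e] stands one period after the first letter of [R]. *)
have letterE w' e : L (v ++ w' ++ rcons R e) -> size (v ++ w' ++ rcons R e) <= N ->
    e = nth a R 0.
  move=> Le sN; have [y [z [Lyz _ sz]]] := lang_room N Le.
  have [|||y1 [z1 [_ E1]]] := Ht y (w' ++ rcons R e ++ z); rewrite ?st//.
  - by rewrite -!catA in Lyz *.
  - by rewrite !size_cat; lia.
  rewrite !size_cat size_rcons sR in sN.
  have E j : j <= P -> nth a (v ++ t) (size v + size w' + j) = nth a (rcons R e) j.
    move=> jP; have := congr1 (fun r => nth a (v ++ r) (size v + size w' + j)) E1.
    rewrite [v ++ t ++ z1]catA [X in _ = X]nth_cat size_cat st ifT; last by lia.
    move=> <-; rewrite nth_cat ifN; last by lia.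
    rewrite nth_cat ifN; last by lia.
    rewrite nth_cat size_rcons sR ifT; last by lia.
    by congr nth; lia.
  have := E P (leqnn _); rewrite nth_rcons sR ltnn eqxx => <-.
  rewrite per; last by lia.
  have := E 0 (leq0n _); rewrite addn0 => ->.
  by rewrite nth_rcons sR ifT //; lia.
apply: cd; transitivity (nth a R 0).
  by apply: (letterE _ _ L1); exact: leq_addr.
by apply/esym/(letterE _ _ L2); exact: leq_addl.
Qed.

(* A period [p <= size t] of the word would make [v] occur again [p] letters
   later inside it, so that a letter of [t] is the only right extension. *)
Lemma forced_period s v t p : forced L s v t -> rspecial L (s ++ v ++ t) ->
  0 < p -> drop p (s ++ v ++ t) = take (size (s ++ v ++ t) - p) (s ++ v ++ t) ->
  size t < p.
Proof.
move=> H [c [d [cd Lc Ld]]] p0 per; rewrite ltnNge; apply/negP => pt.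
have letter e : L (rcons (s ++ v ++ t) e) -> e = nth e t (size t - p).
  move=> Le; have [y [z [Lyz sy sz]]] := lang_room (size s + size t) Le.
  set B := s ++ v ++ t in per Lyz.
  have EB : B = take p B ++ s ++ v ++ take (size t - p) t.
    rewrite -{1}(cat_take_drop p B); congr (_ ++ _).
    rewrite per /B [s ++ v ++ t]catA take_cat ifN; last by rewrite !size_cat; lia.
    by rewrite -catA; congr (_ ++ _ ++ take _ _); rewrite !size_cat; lia.
  have [|||y' [z' [_ Ez]]] := H (y ++ take p B ++ s) (take (size t - p) t ++ e :: z).
  - by move: Lyz; rewrite {1}EB cat_rcons -!catA.
  - by rewrite !size_cat; lia.
  - by rewrite size_cat size_takel /=; lia.
  have := congr1 (fun r => nth e r (size t - p)) Ez.
  rewrite nth_cat size_takel; last by lia.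
  rewrite ltnn subnn /= nth_cat ifT //; lia.
apply: cd; rewrite (letter c Lc) (letter d Ld).
by apply: set_nth_default; lia.
Qed.

End Forced.

(** * Special words and the mirror images of the one-sided results *)

Section Closure.
Variables (A : finType) (L : seq A -> Prop).
Hypotheses (A_gt1 : 1 < #|A|) (arL : ar_language L).
Implicit Types (u v w s t y z B : seq A).

Let arR := ar_language_rev arL.

Let fac u v w : L (u ++ v ++ w) -> L v.
Proof. by case: arL => + _ _ _ => /(_ u v w). Qed.

Lemma rspecial_lang v : rspecial L v -> L v.
Proof. by move=> [c [_ [_ Lc _]]]; apply: (@fac [::] _ [:: c]); rewrite cats1. Qed.

Lemma rspecial_suffix u v : rspecial L (u ++ v) -> rspecial L v.
Proof.
by move=> [c [d [cd Lc Ld]]]; exists c, d; split=> //; move: Lc Ld;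
   rewrite !rcons_cat => Lc Ld; [exact: lang_suffix Lc|exact: lang_suffix Ld].
Qed.

Lemma lspecial_prefix u v : lspecial L (u ++ v) -> lspecial L u.
Proof.
by move=> [c [d [cd Lc Ld]]]; exists c, d; split=> //;
   [exact: (@lang_prefix _ _ arL (c :: u) v Lc)|exact: (@lang_prefix _ _ arL (d :: u) v Ld)].
Qed.

Lemma rspecial_inj u v : rspecial L u -> rspecial L v -> size u = size v -> u = v.
Proof.
case: arL => _ _ + _ ru rv suv => /(_ (size v))[R [_ _ uR]].
by rewrite (uR u suv) // (uR v erefl).
Qed.

Lemma lspecial_inj u v : lspecial L u -> lspecial L v -> size u = size v -> u = v.
Proof.
case: arL => _ _ _ + lu lv suv => /(_ (size v))[R [_ _ uR]].
by rewrite (uR u suv) // (uR v erefl).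
Qed.

Lemma rspecial_ext v c : rspecial L v -> L (rcons v c).
Proof.
by case: arL => _ _ + _ rv => /(_ (size v))[R [_ LR uR]]; rewrite (uR v erefl).
Qed.

Lemma rspecial_exists n : exists2 R, size R = n & rspecial L R.
Proof.
case: arL => _ _ /(_ n)[R [sR LR _]] _; exists R => //.
by have /card_gt1P[c [d [_ _ /eqP cd]]] := A_gt1; exists c, d.
Qed.

Lemma forced_rspecial s v t s' t' : rspecial L (s ++ v ++ t) ->
  forced L s' v t' -> size t' <= size t.
Proof.
move=> /lspecial_rev + /forced_rev fv; rewrite !rev_cat -catA => lv.
by have := forced_lspecial A_gt1 arR lv fv; rewrite !size_rev.
Qed.

Lemma forced_rcons s g v t : L (g :: v) -> ~ lspecial L v ->
  forced L s (g :: v) t -> forced L (rcons s g) v t.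
Proof.
move=> Lgv nls /forced_rev fv; apply/forced_rev; rewrite rev_rcons.
apply: (forced_cons arR); rewrite -?rev_cons//.
- by rewrite /revl revK.
- by move=> /(rspecial_rev L v).2.
Qed.

Lemma lspecial_forced v : L v -> exists s, lspecial L (s ++ v) /\ forced L s v [::].
Proof.
move=> Lv; have [|t [rt ft]] := @rspecial_forced _ _ A_gt1 arR (rev v).
  by rewrite /revl revK.
exists (rev t); split; first by apply/rspecial_rev; rewrite rev_cat revK.
by apply/forced_rev; rewrite revK.
Qed.

Lemma forced_period_left s v t p : forced L s v t -> lspecial L (s ++ v ++ t) ->
  0 < p -> drop p (s ++ v ++ t) = take (size (s ++ v ++ t) - p) (s ++ v ++ t) ->
  size s < p.
Proof.
move=> /forced_rev fv /rspecial_rev + p0 per.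
rewrite !rev_cat -catA => rv; rewrite -size_rev.
apply: (forced_period A_gt1 arR fv rv p0).
have -> : rev t ++ rev v ++ rev s = rev (s ++ v ++ t) by rewrite !rev_cat catA.
by rewrite drop_rev -per rev_drop size_rev.
Qed.

End Closure.

(** * The bispecial closure of a factor and a criterion for forced factorizations *)

Section Bispecial.
Variables (A : finType) (L : seq A -> Prop).
Hypotheses (A_gt1 : 1 < #|A|) (arL : ar_language L).
Implicit Types (u v w s t y z B : seq A).

Let fac u v w : L (u ++ v ++ w) -> L v.
Proof. by case: arL => + _ _ _ => /(_ u v w). Qed.

Definition bispec v := rspecial L v /\ lspecial L v.

(** Extend [v] to a right special [v ++ t], then extend this to the left. The second extension keeps
    right speciality, since [s] is forced before [v ++ t] whatever letter follows. *)
Lemma closure_exists v : L v -> exists s t, forced L s v t /\ bispec (s ++ v ++ t).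
Proof.
move=> Lv; have [t [rt ft]] := rspecial_forced A_gt1 arL Lv.
have [s [ls fs]] := lspecial_forced A_gt1 arL (rspecial_lang arL rt).
exists s, t; split; last split=> //.
  move=> y z Lyz sy sz; have [//|//|_ [z' [_ Ez]]] := ft _ _ Lyz.
  have [|//|//|y' [_ [Ey _]]] := fs y z'; first by rewrite -catA -Ez.
  by exists y', z'.
case: rt => c [d [cd Lc Ld]]; exists c, d.
have ext e : L (rcons (v ++ t) e) -> L (rcons (s ++ v ++ t) e).
  move=> /(lang_room A_gt1 arL (size s))[y [z [Lyz sy _]]].
  have [|//|//|y' [_ [Ey _]]] := fs y (e :: z); first by rewrite -cat_rcons.
  by rewrite Ey -!catA in Lyz; apply: (@fac y' _ z); rewrite rcons_cat -!catA.
by split=> //; exact: ext.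
Qed.

(** Each bispecial word bounds the forced parts of the other, so the lengths agree; both pairs then
    flank the same occurrence of [v]. *)
Lemma closure_unique s v t s' t' : L v -> forced L s v t -> forced L s' v t' ->
  bispec (s ++ v ++ t) -> bispec (s' ++ v ++ t') -> s = s' /\ t = t'.
Proof.
move=> Lv f f' [r l] [r' l'].
have ss : size s = size s'.
  by apply/eqP; rewrite eqn_leq (forced_lspecial A_gt1 arL l' f)
    (forced_lspecial A_gt1 arL l f').
have tt : size t = size t'.
  by apply/eqP; rewrite eqn_leq (forced_rspecial A_gt1 arL r' f)
    (forced_rspecial A_gt1 arL r f').
have [y [z [Lyz sy sz]]] := lang_room A_gt1 arL (size s + size t) Lv.
have [||y1 [z1 [Ey Ez]]] := f _ _ Lyz; try lia.
have [||y2 [z2 [Ey' Ez']]] := f' _ _ Lyz; try lia.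
rewrite Ey in Ey'; rewrite Ez in Ez'; split.
  have sy12 : size y1 = size y2 by have := congr1 size Ey'; rewrite !size_cat; lia.
  by move/eqP: Ey'; rewrite eqseq_cat // => /andP[_ /eqP].
by move/eqP: Ez'; rewrite eqseq_cat // => /andP[/eqP].
Qed.

Lemma forced_prefix u t : L (u ++ t) ->
  (forall t1 t2, t = t1 ++ t2 -> t2 != [::] -> ~ rspecial L (u ++ t1)) ->
  forced L [::] u t.
Proof.
elim: t u => [|c t IH] u Lut nrs; first exact: forced0.
apply: (forced_cons arL).
- by apply: (lang_prefix arL (v := t)); rewrite cat_rcons.
- by have := nrs [::] (c :: t) erefl isT; rewrite cats0.
- apply: IH; first by rewrite cat_rcons.
  by move=> t1 t2 Et /(nrs (c :: t1)); rewrite cat_rcons Et; apply.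
Qed.

(* Induction on [size s + size t], extending [v] inside [s ++ v ++ t].  When [v]
   is bispecial with neighbours [g] and [f], let [g' v] be right special: if
   [g' = g] then [g v] is right special, else [g v f] and [g' v f] make [v f] left
   special, and either contradicts the induction hypothesis. *)
Lemma forced_bispec q s v t : bispec (s ++ v ++ t) ->
  (forall u, bispec u -> size u < size (s ++ v ++ t) ->
     size u + q <= size (s ++ v ++ t)) ->
  size s < q -> size t < q -> forced L s v t.
Proof.
move=> bB; have [n] := ubnP (size s + size t).
elim: n s v t bB => // n IH s v t bB ltn gap sq tq.
have Lsvt := rspecial_lang arL bB.1.
have [rv|nrv] := pselect (rspecial L v); last first.
  case: t => [|f t] in bB ltn gap tq Lsvt *.
    by case: nrv; rewrite cats0 in bB; exact: (rspecial_suffix arL bB.1).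
  apply: (forced_cons arL) => //.
    by apply: (@fac s _ t); rewrite cat_rcons.
  by apply: IH; rewrite ?cat_rcons//; move: ltn tq => /=; lia.
have [lv|nlv] := pselect (lspecial L v); last first.
  case/lastP: s => [|s g] in bB ltn gap sq Lsvt *.
    by case: nlv; exact: (@lspecial_prefix _ _ arL v t bB.2).
  rewrite cat_rcons in Lsvt bB gap; apply: (forced_rcons arL) => //.
    exact: (@fac s (g :: v) t).
  by rewrite size_rcons in ltn sq; apply: IH => //; lia.
have [sB|/(gap _ (conj rv lv))] := leqP (size (s ++ v ++ t)) (size v).
  have [/eqP/nilP-> /eqP/nilP->] : size s = 0 /\ size t = 0.
    by move: sB; rewrite !size_cat; lia.
  exact: forced0.
rewrite !size_cat => sB.
(* Now [size s + size t] is at least [q] while each term is below [q], so neither word is empty. *)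
case: t => [|f t] in bB ltn gap tq Lsvt sB *; first by move: sB sq => /=; lia.
case/lastP: s => [|s g] in bB ltn gap sq Lsvt sB *; first by move: sB tq => /=; lia.
exfalso.
have ff : forced L (rcons s g) (rcons v f) t.
  have EB : rcons s g ++ rcons v f ++ t = rcons s g ++ v ++ f :: t.
    by rewrite (cat_rcons f).
  by apply: IH; rewrite ?EB//; move: ltn tq => /=; lia.
have fg : forced L s (g :: v) (f :: t).
  rewrite cat_rcons in bB gap.
  by rewrite size_rcons in ltn sq; apply: IH => //; lia.
(* The right special word one letter longer than [v] ends with [v], the only right special word of
   its length. *)
have [[|g' v'] [sR] rR] := rspecial_exists A_gt1 arL (size v).+1 => //.
have Ev' : v' = v.
  by apply: (rspecial_inj arL) => //; exact: (rspecial_suffix arL (u := [:: g'])).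
rewrite {v' sR}Ev' in rR.
have [Eg|ng] := eqVneq g' g.
  rewrite Eg in rR; have := @forced_rspecial _ _ A_gt1 arL [::] (g :: v) [::] _ _.
  by rewrite cats0 => /(_ _ _ rR fg).
suff lf : lspecial L (rcons v f).
  have := @forced_lspecial _ _ A_gt1 arL [::] (rcons v f) [::] _ _.
  by rewrite cats0 => /(_ _ _ lf ff); rewrite size_rcons.
exists g', g; split; first exact/eqP.
  exact: (rspecial_ext arL f rR).
by apply: (@fac s _ t); rewrite /= cat_rcons -cat_rcons.
Qed.

End Bispecial.

(** * Complete first returns as words with two end occurrences *)

Section Returns.
Variable A : finType.
Implicit Types (L : seq A -> Prop) (u v w s t y z B : seq A).

Lemma prefix_dropP v u i : i <= size u -> prefix v (drop i u) ->
  exists y z, u = y ++ v ++ z /\ size y = i.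
Proof.
move=> iu /prefixP[z Ez]; exists (take i u), z.
by rewrite -Ez cat_take_drop size_takel.
Qed.

Lemma prefix_drop_size v u i : i <= size u -> prefix v (drop i u) ->
  i + size v <= size u.
Proof. by move=> iu /size_prefix/=; rewrite size_drop; lia. Qed.

Lemma prefix_drop_take v u i m : i + size v <= m ->
  prefix v (drop i (take m u)) = prefix v (drop i u).
Proof. by move=> im; rewrite !prefixE /= !take_drop take_takel // addnC. Qed.

(** Turning the count into a condition on each position reduces later arguments about occurrences to
    index arithmetic. *)
Lemma two_end_occP v u : two_end_occ v u <->
  size v < size u /\ forall i, i + size v <= size u ->
    prefix v (drop i u) = (i == 0) || (i + size v == size u).
Proof.
rewrite /two_end_occ /nb_occ -size_filter.
set s := filter _ _.
have us : uniq s by rewrite filter_uniq ?iota_uniq.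
have ins i : (i \in s) = (i <= size u) && prefix v (drop i u).
  by rewrite mem_filter mem_iota ltnS andbC.
split=> [[s2 pv sv]|[lt_vu occ]].
  have /= svu := size_prefix pv.
  have e_in : size u - size v \in s.
    rewrite ins leq_subr /=; move: sv; rewrite suffixE /= => /eqP->.
    exact: prefix_refl.
  have z_in : 0 \in s by rewrite ins drop0.
  have lt_vu : size v < size u.
    rewrite ltnNge; apply/negP => le_uv.
    have /(uniq_leq_size us) : {subset s <= [:: 0]}.
      move=> i; rewrite ins inE => /andP[iu /(prefix_drop_size iu)]; lia.
    by rewrite s2.
  split=> // i iv.
  have u2 : uniq [:: 0; size u - size v] by rewrite /= inE; lia.
  have sub2 : {subset [:: 0; size u - size v] <= s}.
    by move=> j; rewrite !inE => /orP[]/eqP->.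
  have [_ eqs] := uniq_min_size u2 sub2 (eq_leq s2).
  have := eqs i; rewrite ins !inE; lia.
have Es : s =i [:: 0; size u - size v].
  move=> i; rewrite ins !inE.
  have [iv|iv] := leqP (i + size v) (size u).
    by rewrite (occ _ iv); lia.
  have [iu|] := leqP i (size u); last by lia.
  have -> : prefix v (drop i u) = false.
    by apply/negP => /(prefix_drop_size iu); lia.
  by lia.
have u2 : uniq [:: 0; size u - size v] by rewrite /= inE; lia.
split.
- by rewrite (perm_size (uniq_perm us u2 Es)).
- by have := Es 0; rewrite ins drop0 !inE.
- have := Es (size u - size v); rewrite ins !inE eqxx orbT => /andP[_].
  rewrite suffixE prefixE /= take_oversize; last by rewrite size_drop; lia.
  done.
Qed.

Lemma two_end_occ_size v u : two_end_occ v u -> size v < size u.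
Proof. by move=> /two_end_occP[]. Qed.

Lemma two_end_occ_nil u : two_end_occ [::] u <-> size u = 1.
Proof.
split=> [/two_end_occP[/= u0 /(_ 1)]|]; first by rewrite prefix0s /=; lia.
by case: u => [|c []]//= _; apply/two_end_occP; split=> // -[|[]].
Qed.

(** The longer word [v'] ends with [v] and is a proper prefix of [w], so this copy of [v] is not the
    final one in [w]. It is therefore the initial one, and [v' = v]. *)
Lemma two_end_occ_inj v v' w : two_end_occ v w -> two_end_occ v' w -> v = v'.
Proof.
wlog svv : v v' / size v <= size v'.
  move=> H; have [|/ltnW] := leqP (size v) (size v'); first exact: H.
  by move=> le o o'; apply/esym/H.
move=> o o'; have lt' := two_end_occ_size o'.
have /two_end_occP[lt_vw occ] := o.
case: o o' => _ _ sv [_ /prefixP[z' /= Ew'] /suffixP[y' /= Ew'']].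
have [y Ev'] : exists y, v' = y ++ v.
  exists (take (size v' - size v) v'); rewrite -{1}(cat_take_drop (size v' - size v) v').
  congr (_ ++ _); move: sv; rewrite suffixE /= {2}Ew'' drop_cat.
  have sw := congr1 size Ew''; rewrite size_cat in sw.
  rewrite ltnNge (_ : size y' <= _) => [/eqP Ev|/=]; last by lia.
  by rewrite -[RHS]Ev; congr drop; lia.
have sy := congr1 size Ev'; rewrite size_cat in sy.
have := occ (size y); rewrite Ew' Ev' -!catA drop_size_cat // prefix_prefix.
rewrite !size_cat => /(_ _)/esym; rewrite leq_add2l leq_addr => /(_ isT) H.
have y0 : y = [::].
  apply/nilP; rewrite /nilp; move: H => /orP[//|/eqP]; rewrite Ew' size_cat in lt'.
  lia.
by rewrite y0.
Qed.

(* The complete first return at the start of [u] is cut out by the first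
   reoccurrence of [v]. *)
Lemma two_end_occ_take v u q : 0 < q -> q <= size u -> prefix v u ->
  prefix v (drop q u) ->
  exists r, [/\ 0 < r, r <= q & two_end_occ v (take (r + size v) u)].
Proof.
move=> q0 qu p0 pq.
have exr : exists r, (0 < r) && prefix v (drop r u) by exists q; rewrite q0.
case: (ex_minnP exr) => r /andP[r0 pr] minr; exists r.
have rq : r <= q by apply: minr; rewrite q0.
split=> //; apply/two_end_occP.
have sr := prefix_drop_size (leq_trans rq qu) pr.
rewrite size_takel //; split=> [|i]; first lia.
rewrite leq_add2r => ir; rewrite prefix_drop_take ?leq_add2r //.
rewrite eqn_add2r; have [->|i0] := posnP i; first by rewrite drop0 p0.
apply/idP/eqP => [pi|->//].
by apply/eqP; rewrite eqn_leq ir minr // i0.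
Qed.

(** Adding [s] in front moves an occurrence of [v] by [size s], and the forced [s] before it moves
    the start back: the index is unchanged. *)
Lemma prefix_drop_forced L s v t w i : L (s ++ w ++ t) -> forced L s v t ->
  i + size v <= size w ->
  prefix v (drop i w) = prefix (s ++ v ++ t) (drop i (s ++ w ++ t)).
Proof.
move=> L_w f iw; apply/idP/idP => [|/prefixP[z]].
  move=> /prefix_dropP[|y [z [Ew sy]]]; first lia.
  have [|||y' [z' [Ey Ez]]] := f (s ++ y) (z ++ t); rewrite ?size_cat; try lia.
    by rewrite Ew -!catA in L_w *.
  have -> : s ++ w ++ t = y' ++ (s ++ v ++ t) ++ z'.
    by rewrite Ew -!catA Ez (catA s y) Ey -!catA.
  rewrite drop_size_cat ?prefix_prefix //.
  by have := congr1 size Ey; rewrite !size_cat; lia.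
move=> /(congr1 (drop (size s))); rewrite drop_drop -!catA drop_size_cat //.
rewrite addnC -drop_drop drop_size_cat // drop_cat.
move=> H; rewrite -(@prefix_drop_take _ _ _ (size w)) // take_size.
have := prefix_prefix v (t ++ z); rewrite -H /=.
case: ltnP => iw'; last first.
  suff v0 : v = [::] by move=> _; rewrite v0 prefix0s.
  by apply: size0nil; lia.
by rewrite !prefixE /= takel_cat ?size_drop //; lia.
Qed.

Lemma two_end_occ_forced L s v t w : L (s ++ w ++ t) -> forced L s v t ->
  two_end_occ v w <-> two_end_occ (s ++ v ++ t) (s ++ w ++ t).
Proof.
move=> L_w f; split=> /two_end_occP[lt occ]; apply/two_end_occP.
  split=> [|i]; rewrite !size_cat; first by lia.
  move=> iw; rewrite -(prefix_drop_forced L_w f); last by lia.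
  by rewrite occ; lia.
rewrite !size_cat in lt occ; split=> [|i iw]; first by lia.
by rewrite (prefix_drop_forced L_w f) // occ; lia.
Qed.

End Returns.

(** * Uniqueness and extension of complete first returns in the language *)

Section LanguageReturns.
Variables (A : finType) (L : seq A -> Prop).
Hypotheses (A_gt1 : 1 < #|A|) (arL : ar_language L).
Implicit Types (u v w s t y z B : seq A).

Let fac u v w : L (u ++ v ++ w) -> L v.
Proof. by case: arL => + _ _ _ => /(_ u v w). Qed.

(* At the first letter where they differ, the common prefix would be right
   special, hence would end with a third occurrence of [B]. *)
Lemma return_unique B w w' : rspecial L B -> L w -> L w' ->
  two_end_occ B w -> two_end_occ B w' ->
  take (size B).+1 w = take (size B).+1 w' -> w = w'.
Proof.
wlog sww : w w' / size w <= size w'.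
  move=> H rB Lw Lw' o o' E; have [|/ltnW] := leqP (size w) (size w') => le.
    exact: H.
  exact/esym/H.
move=> rB Lw Lw' /two_end_occP[ltw occ] /two_end_occP[ltw' occ'] E0.
(* If [w] is a prefix of [w'], its final copy of [B] is a non-initial occurrence in [w'], hence the
   final one there too. *)
suff Ew : w = take (size w) w'.
  have iw : size w - size B + size B <= size w by lia.
  have := occ' _ (leq_trans iw sww).
  rewrite -(prefix_drop_take w' iw) -Ew occ // subnK ?eqxx ?orbT; last exact: ltnW.
  by move=> Es; rewrite Ew take_oversize //; lia.
suff H n : size B < n <= size w -> take n w = take n w'.
  by rewrite -{1}(take_size w) H // ltw leqnn.
elim: n => // n IH /andP[]; rewrite ltnS leq_eqVlt => /orP[/eqP<- _//|Bn nw].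
have En : take n w = take n w' by apply: IH; lia.
have /card_gt0P[a _] : 0 < #|A| by lia.
rewrite !(take_nth a) ?En; try lia.
congr rcons; apply: contrapT => cd.
have rn : rspecial L (take n w).
  exists (nth a w n), (nth a w' n); split=> //.
    rewrite -take_nth //; apply: (@fac [::] _ (drop n.+1 w)).
    by rewrite /= cat_take_drop.
  rewrite En -take_nth; last lia.
  by apply: (@fac [::] _ (drop n.+1 w')); rewrite /= cat_take_drop.
have sn : size (take n w) = n by rewrite size_takel //; lia.
have EB : drop (n - size B) (take n w) = B.
  apply: (rspecial_inj arL) => //; last by rewrite size_drop sn; lia.
  apply: (rspecial_suffix arL (u := take (n - size B) (take n w))).
  by rewrite cat_take_drop.
have := occ (n - size B); rewrite -(@prefix_drop_take _ _ _ _ n) ?EB; last lia.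
by rewrite prefix_refl => /(_ _)/esym; lia.
Qed.

(** The initial copy of [v] forces [s] before [w], and the final copy forces [t] after it. *)
Lemma forced_return_lang s v t w : L w -> two_end_occ v w -> forced L s v t ->
  L (s ++ w ++ t).
Proof.
move=> Lw [_ /prefixP[z /= Ez] /suffixP[y /= Ey]] f.
have [y0 [z0 [L0 sy sz]]] := lang_room A_gt1 arL (size s + size t) Lw.
have [|||y1 [_ [E1 _]]] := f y0 (z ++ z0); rewrite ?size_cat; try lia.
  by rewrite (catA v) -Ez.
have [|||_ [z1 [_ E2]]] := f (y0 ++ y) z0; rewrite ?size_cat; try lia.
  by rewrite -catA (catA y) -Ey.
by rewrite E1 E2 -!catA in L0; apply: (@fac y1 _ z1); rewrite -!catA.
Qed.

End LanguageReturns.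

Lemma sum_interval n lo hi : hi <= n ->
  \sum_(i < n) nat_of_bool (lo <= i < hi) = hi - lo.
Proof.
move=> hn; suff E m : \sum_(i < m) nat_of_bool (lo <= i < hi) = minn m hi - lo.
  by rewrite E; lia.
elim: m => [|m IH]; first by rewrite big_ord0; lia.
by rewrite big_ord_recr /= IH; lia.
Qed.

(** * Gaps and periods of the listed bispecial words, and the count of returns *)

Section Listing.
Variables (A : finType) (L : seq A -> Prop).
Hypotheses (A_gt1 : 1 < #|A|) (arL : ar_language L).
(* [q k] is the paper's [p_k], and [C k a] is the complete first return to [B k]
   that begins with [B k] followed by [a]. *)
Variables (B : nat -> seq A) (p : nat -> A -> nat) (q : nat -> nat)
  (C : nat -> A -> seq A).
Hypotheses (bispecB : forall k, bispec L (B k))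
  (listB : forall v, bispec L v -> exists k, v = B k)
  (ltB : forall k l, k < l -> size (B k) < size (B l))
  (retC : forall k a, [/\ L (C k a), two_end_occ (B k) (C k a),
     prefix (rcons (B k) a) (C k a) & size (C k a) = size (B k) + p k a])
  (q_le : forall k a, q k <= p k a)
  (q_ex : forall k, exists a, q k = p k a).
Implicit Types (u v w s t y z : seq A).

Let fac u v w : L (u ++ v ++ w) -> L v.
Proof. by case: arL => + _ _ _ => /(_ u v w). Qed.

Lemma ltB_inv k l : size (B k) < size (B l) -> k < l.
Proof.
move=> lt; rewrite ltnNge leq_eqVlt; apply/negP => /orP[/eqP E|/ltB]; last lia.
by rewrite E ltnn in lt.
Qed.

Lemma B_inj k l : B k = B l -> k = l.
Proof. by move=> E; have [/ltB|/ltB|//] := ltngtP k l; rewrite E ltnn. Qed.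

Lemma leq_size_B k : k <= size (B k).
Proof. by elim: k => // k /leq_ltn_trans; apply; exact: ltB. Qed.

Lemma p_gt0 k a : 0 < p k a.
Proof. by have [_ /two_end_occ_size lt _ sC] := retC k a; lia. Qed.

Lemma q_gt0 k : 0 < q k.
Proof. by have [a ->] := q_ex k; exact: p_gt0. Qed.

Lemma returnP k w : L w -> two_end_occ (B k) w -> exists a, w = C k a.
Proof.
move=> Lw o; have lt := two_end_occ_size o.
case: (o) => _ /prefixP[[|a z] /= Ew] _; first by rewrite Ew cats0 ltnn in lt.
have [LC oC /prefixP[z' EC] _] := retC k a; exists a.
apply: (return_unique A_gt1 arL (bispecB k).1) => //.
have sB : (size (B k)).+1 = size (rcons (B k) a) by rewrite size_rcons.
by rewrite EC Ew sB -cat_rcons !take_size_cat.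
Qed.

Lemma C_inj k a a' : C k a = C k a' -> a = a'.
Proof.
have [_ _ /prefixP[z Ez] _] := retC k a; have [_ _ /prefixP[z' Ez'] _] := retC k a'.
rewrite Ez Ez' => /eqP; rewrite eqseq_cat ?size_rcons // => /andP[/eqP].
by move=> /rcons_inj[].
Qed.

(** Write [b' = y ++ b], with [b] and [b'] the two successive bispecial words. It is shown that
    [y ++ b'] is in the language and begins with [b'], so some return to [b'] has length at most
    [size y]. *)
Lemma gap_pred k : size (B k) + q k.+1 <= size (B k.+1).
Proof.
have ltk := ltB (ltnSn k); set b := B k in ltk *; set b' := B k.+1 in ltk *.
have Eb : take (size b) b' = b.
  apply: (lspecial_inj arL _ (bispecB k).2); last by rewrite size_takel // ltnW.
  apply: (lspecial_prefix arL (v := drop (size b) b')).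
  by rewrite cat_take_drop; exact: (bispecB k.+1).2.
have Eb2 : drop (size b' - size b) b' = b.
  apply: (rspecial_inj arL _ (bispecB k).1); last by rewrite size_drop subKn // ltnW.
  apply: (rspecial_suffix arL (u := take (size b' - size b) b')).
  by rewrite cat_take_drop; exact: (bispecB k.+1).1.
set y := take (size b' - size b) b'.
have sy : size y = size b' - size b by rewrite size_takel // leq_subr.
have Ey : b' = y ++ b by rewrite -Eb2 cat_take_drop.
case Ez : (drop (size b) b') => [|f z].
  by have := congr1 size Ez; rewrite size_drop /=; lia.
have Ef : b' = rcons b f ++ z by rewrite cat_rcons -{1}Eb -Ez cat_take_drop.
have Lb' : L b' := rspecial_lang arL (bispecB k.+1).1.
(* A right special proper prefix of [b'] longer than [b] would also be left special, hence a
   bispecial word strictly between two consecutive ones. *)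
have f_z : forced L [::] (rcons b f) z.
  apply: (forced_prefix arL); first by rewrite -Ef.
  move=> t1 t2 Et t2n rt.
  have [|i Ei] := @listB (rcons b f ++ t1).
    split=> //; apply: (lspecial_prefix arL (v := t2)).
    by rewrite -catA -Et -Ef; exact: (bispecB k.+1).2.
  have t2s : 0 < size t2 by case: (t2) t2n.
  have s1 := congr1 size Ei; rewrite size_cat size_rcons in s1.
  have s2 := congr1 size Ef; rewrite Et !size_cat size_rcons in s2.
  have ki : k < i by apply: ltB_inv; rewrite -s1 -/b; lia.
  have : i < k.+1 by apply: ltB_inv; rewrite -s1 -/b' s2; lia.
  lia.
(* The word [rcons b' f] is [y ++ rcons b f]; forcing [z] after it yields [y ++ b']. *)
have Lyb : L (y ++ b').
  have [y0 [z0 [L0 _ sz]]] :=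
    lang_room A_gt1 arL (size z) (rspecial_ext arL f (bispecB k.+1).1).
  have [|//|//|_ [z1 [_ E1]]] := f_z (y0 ++ y) z0.
    by move: L0; rewrite -/b' Ey rcons_cat -!catA.
  apply: (@fac y0 _ z1); move: L0; rewrite -/b' {1}Ey E1 rcons_cat Ef.
  by rewrite -!catA.
have pb : prefix b' (y ++ b').
  by rewrite {2}Ef cat_rcons catA -Ey prefix_prefix.
have sb := size_cat y b'.
have [||||r [r0 ry o]] := @two_end_occ_take _ b' (y ++ b') (size y) => //.
- by lia.
- by lia.
- by rewrite drop_size_cat // prefix_refl.
have [|a Ea] := returnP _ o.
  by apply: (lang_prefix arL (v := drop (r + size b') (y ++ b'))); rewrite cat_take_drop.
have := q_le k.+1 a; have [_ _ _] := retC k.+1 a; rewrite -Ea size_takel -/b'; lia.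
Qed.

Lemma gap k u : bispec L u -> size u < size (B k) -> size u + q k <= size (B k).
Proof.
move=> /listB[j ->] /ltB_inv; case: k => // k; rewrite ltnS leq_eqVlt.
move=> /orP[/eqP->|/ltB jk]; first exact: gap_pred.
by have := gap_pred k; lia.
Qed.

(** The shortest complete return begins with [B k] and ends with a copy shifted by [q k]; when the
    copies do not overlap, both sides are empty. *)
Lemma q_period k : drop (q k) (B k) = take (size (B k) - q k) (B k).
Proof.
have [a Ea] := q_ex k; have [_ [_ /prefixP[z /= Ez] /suffixP[y /= Ey]] _ sC] := retC k a.
have [qB|Bq] := leqP (q k) (size (B k)); last first.
  by rewrite drop_oversize ?(eqP (ltnW Bq)) ?take0 // ltnW.
have sy : size y = q k by move: sC; rewrite Ey size_cat /=; lia.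
have : drop (q k) (B k ++ z) = B k by rewrite -Ez Ey -sy drop_size_cat.
rewrite drop_cat; case: ltnP => qB'.
  by move=> E; rewrite -[X in take _ X]E take_size_cat // size_drop.
by move=> _; rewrite drop_oversize // (_ : _ - _ = 0) ?take0 //; lia.
Qed.

Lemma closure_lt k s v t : B k = s ++ v ++ t -> forced L s v t ->
  size s < q k /\ size t < q k.
Proof.
move=> EB f; have [r l] := bispecB k; have per := q_period k; rewrite EB in r l per.
split.
  exact: (forced_period_left A_gt1 arL f l (q_gt0 k) per).
exact: (forced_period A_gt1 arL f r (q_gt0 k) per).
Qed.

Lemma forced_B k s v t : B k = s ++ v ++ t -> size s < q k -> size t < q k ->
  forced L s v t.
Proof.
move=> EB; apply: (forced_bispec A_gt1 arL); rewrite -EB //.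
by move=> u; exact: gap.
Qed.

Lemma bispec_nil : bispec L [::].
Proof.
have /card_gt1P[c [d [_ _ /eqP cd]]] := A_gt1.
case: arL => _ _ /(_ 0)[R [/size0nil-> LR _]] /(_ 0)[R' [/size0nil-> LR' _]].
by split; exists c, d.
Qed.

Lemma B0 : B 0 = [::].
Proof.
have [k Ek] := listB bispec_nil; have := leq_size_B k.
by rewrite -Ek leqn0 => /eqP k0; rewrite Ek k0.
Qed.

Lemma p0 a : p 0 a = 1.
Proof.
have [_ + _ sC] := retC 0 a; rewrite B0 /= in sC *.
by rewrite two_end_occ_nil sC.
Qed.

(** Otherwise, for positive [k], cutting [B k] after [q k - 1] letters leaves two parts shorter than
    [q k]. The empty word would then have closure [B k], although it is its own closure. *)
Lemma double_q k : 2 * q k <= size (B k) + 2.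
Proof.
case: k => [|k]; first by have [a ->] := q_ex 0; rewrite p0; lia.
have := gap bispec_nil (leq_trans (ltn0Sn k) (leq_size_B k.+1)).
rewrite add0n => qB; rewrite leqNgt; apply/negP => lt; have q0 := q_gt0 k.+1.
set s := take (q k.+1).-1 (B k.+1); set t := drop (q k.+1).-1 (B k.+1).
have EB : B k.+1 = s ++ [::] ++ t by rewrite cat_take_drop.
have ss : size s = (q k.+1).-1 by rewrite size_takel //; lia.
have st : size t = size (B k.+1) - (q k.+1).-1 by rewrite size_drop.
have f : forced L s [::] t by apply: (forced_B EB); lia.
have Ln := rspecial_lang arL bispec_nil.1.
have [||] := closure_unique A_gt1 arL Ln f (forced0 (v := [::])).
- by rewrite -EB.
- exact: bispec_nil.
by move=> s0 t0; have := leq_size_B k.+1; rewrite EB s0 t0.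
Qed.

(* [i] is [size s] in a factorization [B k = s ++ v ++ t] with [size v = n - p k a],
   [size s < q k] and [size t < q k]. *)
Definition good n k a i :=
  [&& p k a <= n, i < q k, i + n <= size (B k) + p k a
    & size (B k) + p k a < i + n + q k].

Definition good_word n k a i := take n (drop i (C k a)).

Lemma good_split n k a i : good n k a i -> exists s v t,
  [/\ B k = s ++ v ++ t, forced L s v t & C k a = s ++ good_word n k a i ++ t] /\
  [/\ size s = i, size (good_word n k a i) = n, L (good_word n k a i)
    & two_end_occ v (good_word n k a i)].
Proof.
move=> /and4P[pn iq inB Bin]; set W := good_word n k a i.
have [LC oC _ sC] := retC k a.
have [_ /prefixP[z /= Ez] /suffixP[y /= Ey]] := oC.
have sy : size y = p k a by move: sC; rewrite Ey size_cat /=; lia.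
have iB : i <= size (B k) by lia.
set m := n - p k a.
(* The return [C k a] also ends with [B k], shifted by [p k a]. Hence removing [s] and [t] from it
   leaves [m + p k a = n] letters. *)
exists (take i (B k)), (take m (drop i (B k))), (drop m (drop i (B k))).
set s := take i _; set v := take m _; set t := drop m _.
have EB : B k = s ++ v ++ t by rewrite !cat_take_drop.
have ss : size s = i by rewrite size_takel.
have st : size t = size (B k) - i - m by rewrite !size_drop.
have f : forced L s v t by apply: (forced_B EB); rewrite ?ss ?st /m; lia.
have sW : size W = n by rewrite size_takel // size_drop; lia.
have EC : C k a = s ++ W ++ t.
  have -> : s = take i (C k a) by rewrite Ez takel_cat.
  have -> : t = drop n (drop i (C k a)).
    rewrite /t !drop_drop Ey drop_cat sy ifN; last by lia.
    by congr drop; rewrite /m; lia.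
  by rewrite !cat_take_drop.
do 2!split=> //; first by rewrite EC in LC; exact: (@fac s _ t).
rewrite EC in LC; apply/(two_end_occ_forced LC f); rewrite -EC -EB.
exact: oC.
Qed.

(** The closure of [v] is some [B k], and [w] extends to a complete return [C k a]; the index is the
    length of the left extension. *)
Lemma good_wordP v w : L w -> two_end_occ v w ->
  exists k a i, good (size w) k a i /\ w = good_word (size w) k a i.
Proof.
move=> Lw o; have lt := two_end_occ_size o.
have Lv : L v.
  by case: o => _ /prefixP[z /= Ez] _; rewrite Ez in Lw; exact: (lang_prefix arL Lw).
have [s [t [f /listB[k Ek]]]] := closure_exists A_gt1 arL Lv.
have Lswt := forced_return_lang A_gt1 arL Lw o f.
have /(two_end_occ_forced Lswt f) := o; rewrite Ek => /(returnP Lswt)[a Ea].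
have [sq tq] := closure_lt (esym Ek) f.
have [_ _ _] := retC k a; rewrite -Ea -Ek !size_cat => sC.
exists k, a, (size s); split; last first.
  by rewrite /good_word -Ea drop_size_cat // take_size_cat.
by rewrite /good -Ek !size_cat; lia.
Qed.

(** The word determines [v], its closure determines [k] and [i], and the extended return determines
    [a]. *)
Lemma good_word_inj n k a i k' a' i' : good n k a i -> good n k' a' i' ->
  good_word n k a i = good_word n k' a' i' -> [/\ k = k', a = a' & i = i'].
Proof.
move=> /good_split[s [v [t [[EB f EC] [ss _ LW o]]]]].
move=> /good_split[s' [v' [t' [[EB' f' EC'] [ss' _ _ o']]]]] EW.
rewrite -EW in o' EC'.
have Ev := two_end_occ_inj o o'; rewrite -Ev in EB' f'.
have Lv : L v.
  by case: o => _ /prefixP[z /= Ez] _; rewrite Ez in LW; exact: (lang_prefix arL LW).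
have [||Es Et] := closure_unique A_gt1 arL Lv f f'.
- by rewrite -EB.
- by rewrite -EB'.
have Ek : k = k' by apply: B_inj; rewrite EB EB' Es Et.
split=> //; last by rewrite -ss -ss' Es.
by rewrite -Ek in EC'; apply: (@C_inj k); rewrite EC EC' Es Et.
Qed.

(** The hypothesis is the lower end of the interval. [double_q] gives the first bound; the gap below
    [B k] and [leq_size_B] give the second. *)
Lemma index_bound n k a :
  size (B k) + p k a + 2 <= n + 2 * q k -> p k a <= n /\ k < n.
Proof.
have qp := q_le k a; have dq := double_q k; move=> le.
have pn : p k a <= n by lia.
split=> //; have pg := p_gt0 k a; case: k => [|k] in qp dq le pn pg *; first lia.
by have := gap_pred k; have := leq_size_B k; lia.
Qed.

Lemma good_bound n k a i : good n k a i -> k < n /\ i < n.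
Proof.
move=> /and4P[pn iq inB Bin]; have qp := q_le k a.
by have [|_ kn] := @index_bound n k a; [lia|split => //; lia].
Qed.

(* [d(n, I_{k,a}) + 1] if [n] lies in [I_{k,a}], and [0] otherwise. *)
Definition hat n k a :=
  if (n <= size (B k) + p k a) && (size (B k) + p k a + 2 <= n + 2 * q k) then
    (minn (size (B k) + p k a - n) (n + 2 * q k - (size (B k) + p k a + 2))).+1
  else 0.

Lemma sum_good n k a : \sum_(i < n) good n k a i = hat n k a.
Proof.
rewrite /hat; case: ifPn => [/andP[nB nq]|out].
  have [pn _] := index_bound nq; have qp := q_le k a.
  (* The conditions confine [i] to a single interval; truncated subtraction supplies its lower bound
     0 when needed. *)
  rewrite (eq_bigr (fun i : 'I_n => nat_of_bool
    ((size (B k) + p k a - n).+1 - q k <= i < minn (q k) (size (B k) + p k a - n).+1))).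
    by rewrite sum_interval; lia.
  by move=> i _; congr nat_of_bool; rewrite /good; lia.
by rewrite big1 // => i _; rewrite /good; lia.
Qed.

Lemma card_returns n (P : pred (n.-tuple A)) :
  (forall w : n.-tuple A, P w <-> L w /\ exists v, two_end_occ v w) ->
  #|P| = \sum_(a : A) \sum_(k < n) hat n k a.
Proof.
move=> PE; have /card_gt0P[a0 _] : 0 < #|A| by lia.
pose G := [set r : A * ('I_n * 'I_n) | good n r.2.1 r.1 r.2.2].
(* The constant tuple is a default that is never reached on [G], where the words have length [n]. *)
pose f (r : A * ('I_n * 'I_n)) : n.-tuple A :=
  insubd (nseq_tuple n a0) (good_word n r.2.1 r.1 r.2.2).
have fE r : r \in G -> f r = good_word n r.2.1 r.1 r.2.2 :> seq A.
  rewrite inE => /good_split[s [v [t [_ [_ sW _ _]]]]].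
  by rewrite val_insubd sW eqxx.
have f_inj : {in G &, injective f}.
  move=> [a [k i]] [a' [k' i']] Gr Gr' /(congr1 val) /=.
  rewrite !fE //= => E; rewrite !inE /= in Gr Gr'.
  by have [/val_inj-> -> /val_inj->] := good_word_inj Gr Gr' E.
have -> : #|P| = #|G|.
  rewrite -(card_in_imset f_inj); apply: eq_card => w.
  apply/idP/imsetP => [/PE[Lw [v o]]|[r Gr ->]].
    have [k [a [i [g Ew]]]] := good_wordP Lw o; rewrite size_tuple in g Ew.
    have [kn ni] := good_bound g.
    have Gr : (a, (Ordinal kn, Ordinal ni)) \in G by rewrite inE.
    by exists (a, (Ordinal kn, Ordinal ni)) => //; apply: val_inj; rewrite /= fE.
  apply/PE; rewrite fE //; move: Gr; rewrite inE.
  by move=> /good_split[s [v [t [_ [_ _ LW o]]]]]; split=> //; exists v.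
transitivity (\sum_(a : A) \sum_(ki : 'I_n * 'I_n) nat_of_bool ((a, ki) \in G)).
  rewrite pair_bigA /= -sum1_card big_mkcond.
  by apply: eq_bigr => -[a ki] _ /=; case: ifP.
apply: eq_bigr => a _.
transitivity (\sum_(k < n) \sum_(i < n) nat_of_bool ((a, (k, i)) \in G)).
  by rewrite pair_bigA; apply: eq_bigr => -[k i].
by apply: eq_bigr => k _; rewrite -sum_good; apply: eq_bigr => i _; rewrite inE.
Qed.

End Listing.

(** * From the infinite word to its language of factors *)

Section ArnouxRauzy.
Variables (A : finType) (x : nat -> A).
Implicit Types (u v w : seq A).

Lemma occurs_at_cat u v i :
  occurs_at x (u ++ v) i <-> occurs_at x u i /\ occurs_at x v (i + size u).
Proof.
rewrite /occurs_at size_cat /mkseq iotaD map_cat add0n.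
have -> : [seq x (i + j) | j <- iota (size u) (size v)]
    = [seq x (i + size u + j) | j <- iota 0 (size v)].
  rewrite -{1}(addn0 (size u)) iotaDl -map_comp.
  by apply: eq_map => j /=; rewrite addnA.
split=> [/eqP|[<- <-]//].
by rewrite eqseq_cat ?size_map ?size_iota // => /andP[/eqP ? /eqP].
Qed.

Lemma factor_infix u v w : factor x (u ++ v ++ w) -> factor x v.
Proof. by move=> [i /occurs_at_cat[_ /occurs_at_cat[ov _]]]; exists (i + size u). Qed.

Lemma right_specialE v : right_special x v <-> rspecial (factor x) v.
Proof.
split=> [[_ //]|sv]; split=> //; case: sv => c [d [_ + _]].
by rewrite -cats1; exact: (@factor_infix [::] v [:: c]).
Qed.

Lemma left_specialE v : left_special x v <-> lspecial (factor x) v.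
Proof.
split=> [[_ //]|sv]; split=> //; case: sv => c [d [_ + _]].
by move=> Lc; apply: (@factor_infix [:: c] v [::]); rewrite cats0.
Qed.

Lemma bispecialE v : bispecial x v <-> bispec (factor x) v.
Proof. by rewrite /bispecial right_specialE left_specialE. Qed.

Lemma ar_language_factor : arnoux_rauzy x -> ar_language (factor x).
Proof.
move=> [recx rs ls]; split.
- exact: factor_infix.
- move=> u v [i ui] /recx/(_ (i + size u))[j ij vj].
  exists (mkseq (fun k => x (i + size u + k)) (j - (i + size u))), i.
  apply/occurs_at_cat; split=> //; apply/occurs_at_cat.
  by rewrite /occurs_at size_mkseq subnKC.
- move=> n; have [R [[[sR _] uR] LR]] := rs n; exists R; split=> // v sv.
  by move=> /right_specialE rv; rewrite (uR v).
- move=> n; have [R [[[sR _] uR] LR]] := ls n; exists R; split=> // v sv.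
  by move=> /left_specialE lv; rewrite (uR v).
Qed.

Lemma closed_wordE w : closed_word w <-> exists v, two_end_occ v w.
Proof.
split=> [[/two_end_occ_nil o|[v [_ _ _ o]]]|[v o]]; [by exists [::]|by exists v|].
(* The empty word occurs exactly twice only in words of length 1, which are closed by convention. *)
have [v0|/eqP v0] := eqVneq v [::]; first by left; rewrite v0 in o; exact/two_end_occ_nil.
right; exists v; split=> //; first by case: o => _ /prefixW.
by move=> E; have := two_end_occ_size o; rewrite E ltnn.
Qed.

Lemma min_return_le p k a : min_return x p k <= p k a.
Proof.
rewrite /min_return; have : a \in index_enum A by rewrite mem_index_enum.
elim: (index_enum A) => // b r IH; rewrite big_cons inE => /orP[/eqP<-|/IH].
  exact: geq_minl.
by apply: leq_trans; exact: geq_minr.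
Qed.

Lemma min_return_ex p k : exists a, min_return x p k = p k a.
Proof.
rewrite /min_return; apply: (big_ind (fun m => exists a, m = p k a)).
- by exists (x 0).
- by move=> m m' em em'; rewrite /minn; case: ifP.
- by move=> a _; exists a.
Qed.

End ArnouxRauzy.

(** * The formula for the number of closed factors *)

Theorem theorem1 (A : finType) (x : nat -> A)
    (B : nat -> seq A) (p : nat -> A -> nat) :
  1 < #|A| ->
  arnoux_rauzy x ->
  bispecial_listing x B ->
  return_lengths x B p ->
  forall n : nat, 0 < n ->
    (forall a : A, finite_set (I_indices x B p a n)) /\
    nb_closed_factors x n = \sum_(a : A) F_sum x B p a n.
Proof.
move=> A_gt1 /ar_language_factor arL [bisB listB ltB] retp n n_gt0.
have bispecB k : bispec (factor x) (B k) by exact/bispecialE.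
have listB' v : bispec (factor x) v -> exists k, v = B k.
  by move=> /bispecialE; exact: listB.
have [C retC] : exists C : nat -> A -> seq A, forall k a,
    [/\ factor x (C k a), two_end_occ (B k) (C k a),
      prefix (rcons (B k) a) (C k a) & size (C k a) = size (B k) + p k a].
  have /choice[C retC] ka : exists w, [/\ factor x w, two_end_occ (B ka.1) w,
      prefix (rcons (B ka.1) ka.2) w & size w = size (B ka.1) + p ka.1 ka.2].
    have [u [[Lu ou] pu su]] := retp ka.1 ka.2; exists (u ++ B ka.1).
    by split=> //; rewrite size_cat su addnC.
  by exists (fun k a => C (k, a)) => k a; exact: retC (k, a).
pose q := min_return x p.
have q_le k a : q k <= p k a by exact: min_return_le.
have q_ex k : exists a, q k = p k a by exact: min_return_ex.
(* Moving [2 * q k] to the other side of the lower bound replaces integers by naturals without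
   truncation. *)
have IE k a : k \in I_indices x B p a n =
    (n <= size (B k) + p k a) && (size (B k) + p k a + 2 <= n + 2 * q k).
  apply/idP/idP; rewrite inE /I_indices /mkset /I_lo /I_hi -[min_return x p k]/(q k); lia.
(* This gives finiteness and lets each sum over indices run over [k < n]. *)
have I_lt k a : k \in I_indices x B p a n -> k < n.
  by rewrite IE => /andP[_ /(index_bound A_gt1 arL bispecB listB' ltB retC q_le q_ex)[]].
split=> [a|].
  apply: (sub_finite_set _ (finite_II n)) => k Ik /=.
  by apply: (I_lt k a); rewrite inE.
rewrite /nb_closed_factors.
rewrite (card_returns A_gt1 arL bispecB listB' ltB retC q_le q_ex); last first.
  by move=> w; split=> [/asboolP[Lw /closed_wordE]//|[Lw /closed_wordE cw]]; apply/asboolP.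
apply: eq_bigr => a _.
rewrite /F_sum (@fsbigE _ _ _ _ _ [seq k <- iota 0 n | k \in I_indices x B p a n]).
- rewrite big_filter_cond -[in iota 0 n](subn0 n) -/(index_iota 0 n) big_mkord.
  rewrite [RHS]big_mkcond.
  apply: eq_bigr => k _; rewrite andbb /hat -IE; case: ifP => // Ik.
  rewrite /dist_ends /I_lo /I_hi -[min_return x p k]/(q k); move: Ik; rewrite IE; lia.
- by rewrite filter_uniq ?iota_uniq.
- by move=> k /=; rewrite mem_filter => /andP[]; rewrite inE.
- move=> k Ik; rewrite mem_filter mem_iota /=.
  have Ik' : k \in I_indices x B p a n by rewrite inE.
  by rewrite Ik' (I_lt k a Ik').
Qed.
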